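(* Let $\ell$ be a positive integer. A signed graph $(G,\sigma)$ admits a modulo $\ell$-orientation if and only if there is a partition $\{E_1,\dots,E_\ell\}$ of $E(G)$ such that: (i) for each $i$, $E_i$ is the set of positive edges of some signature on $G$ that is inversing equivalent to $\sigma$; and (ii) there is an orientation of $G$ such that for every vertex $v$ and every $i,j\in\{1,\dots,\ell\}$, $$\overleftarrow{d_{E_i}}(v)-\overrightarrow{d_{E_i}}(v)=\overleftarrow{d_{E_j}}(v)-\overrightarrow{d_{E_j}}(v),$$ where $\overleftarrow{d_{E_i}}(v)$ and $\overrightarrow{d_{E_i}}(v)$ denote the numbers of edges of $E_i$ oriented out of $v$ and into $v$, respectively.
   Context: Graphs are finite, may have multiple edges but no loops; a signed graph $(G,\sigma)$ has $\sigma:E(G)\to\{+,-\}$. Inversing on a cycle means changing the signs of all its edges; two signatures are inversing equivalent if one is obtained from the other by inversing on a sequence of cycles. A signed graph $(G,\sigma)$ is modulo $\ell$-orientable if there exist a signature $\sigma'$ inversing equivalent to $\sigma$ and an orientation $D$ of $G$ such that, with respect to $\sigma'$, for every vertex $v$, $(\ell-1)(\overleftarrow{d^+}(v)-\overrightarrow{d^+}(v))=\overleftarrow{d^-}(v)-\overrightarrow{d^-}(v)$, where $\overleftarrow{d^{+}}(v)$ ($\overrightarrow{d^{+}}(v)$) is the number of positive edges oriented out of (into) $v$, and similarly $\overleftarrow{d^{-}},\overrightarrow{d^{-}}$ for negative edges; such $D$ is a modulo $\ell$-orientation. *)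

(* Defs.v *)
From mathcomp Require Import all_boot all_order all_algebra.

Set Implicit Arguments.
Unset Strict Implicit.
Unset Printing Implicit Defensive.

Import GRing.Theory Num.Theory.
Local Open Scope ring_scope.

(* Finite multigraphs: parallel edges are distinct elements of [edge G] with
   the same ends; [#|ends e| = 2] rules out loops. *)
Record multigraph := Multigraph {
  vertex : finType;
  edge : finType;
  ends : edge -> {set vertex};
  ends_card : forall e, #|ends e| = 2%N }.

Record orientation (G : multigraph) := Orientation {
  tail : edge G -> vertex G;
  head : edge G -> vertex G;
  endsE : forall e, ends e = [set tail e; head e] }.

(* [true] is the sign +, [false] is the sign -. *)
Definition signature (G : multigraph) := {ffun edge G -> bool}.

Section Defs.
Variable G : multigraph.
Implicit Types (s : signature G) (A C : {set edge G}) (D : orientation G).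

Definition pos_edges s : {set edge G} := [set e | s e].
Definition neg_edges s : {set edge G} := [set e | ~~ s e].

(* C is the edge set of a cycle v_0 e_0 v_1 e_1 ... v_(k-1) e_(k-1) v_0 with
   distinct vertices and distinct edges, [ordS] being the successor mod k.
   The case k = 2 is a pair of parallel edges. *)
Definition is_cycle C : Prop :=
  exists (k : nat) (v : 'I_k -> vertex G) (e : 'I_k -> edge G),
    [/\ (1 < k)%N, injective v, injective e,
        forall i, ends (e i) = [set v i; v (ordS i)]
      & C = [set e i | i : 'I_k]].

Definition inverse_on s C : signature G :=
  [ffun e => if e \in C then ~~ s e else s e].

Definition inversing_equiv s s' : Prop :=
  exists Cs : seq {set edge G},
    (forall C, C \in Cs -> is_cycle C) /\ s' = foldl inverse_on s Cs.

Definition outdeg D A (v : vertex G) : nat := #|[set e in A | tail D e == v]|.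
Definition indeg D A (v : vertex G) : nat := #|[set e in A | head D e == v]|.

Definition modulo_orientation (l : nat) s D : Prop :=
  forall v : vertex G,
    (l%:Z - 1) * ((outdeg D (pos_edges s) v)%:Z - (indeg D (pos_edges s) v)%:Z)
    = (outdeg D (neg_edges s) v)%:Z - (indeg D (neg_edges s) v)%:Z.

Definition modulo_orientable (l : nat) s : Prop :=
  exists (s' : signature G) (D : orientation G),
    inversing_equiv s s' /\ modulo_orientation l s' D.

(* The parts of a partition {E_1, ..., E_l} are indexed and may be empty. *)
Definition edge_partition (l : nat) (P : 'I_l -> {set edge G}) : Prop :=
  (forall i j, i != j -> [disjoint P i & P j]) /\ \bigcup_i P i = [set: edge G].

End Defs.

(* Main.v *)
Require Import Defs.
From mathcomp Require Import all_boot all_order all_algebra.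
From mathcomp Require Import zify ring.

Set Implicit Arguments.
Unset Strict Implicit.
Unset Printing Implicit Defensive.

Import Order.TTheory GRing.Theory Num.Theory.
Local Open Scope ring_scope.

(** Given a modulo orientation [D] with positive part [E+], the whole edge set
    has net out-degree [l * f], where [f] is the net out-degree of [E+].  An
    [l]-colouring of the edges minimising the sum over colours and vertices of
    the squared net out-degrees has net out-degree [f] in every colour class:
    otherwise two classes differ by at least 2 at some vertex, and exchanging
    the two colours along a path that is directed once the edges of the second
    colour are reversed lowers the sum.  Each class then has degrees of the
    same parity as [E+], so its symmetric difference with [E+] is an even edge
    set, hence a disjoint union of cycles (Veblen).  The converse is a direct
    summation. *)

(** * Paths in directed multigraphs *)

Section Digraph.
Variables (V E : finType) (tl hd : E -> V).

Definition incidence (e : E) (v : V) : int := (tl e == v)%:R - (hd e == v)%:R.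

Definition arc_rel (B : {set E}) : rel V :=
  [rel x y | [exists e in B, (tl e == x) && (hd e == y)]].

(** The clause on tails serves the induction: [x] does not recur on the path, so the arc leaving [x]
    is not yet in [Q], and the sum telescopes. *)
Lemma path_arcs (B : {set E}) (p : seq V) (x : V) :
  path (arc_rel B) x p -> uniq (x :: p) ->
  exists Q : {set E}, [/\ Q \subset B, {in Q, forall e, tl e \in x :: p} &
    forall v, \sum_(e in Q) incidence e v
              = (x == v)%:R - (last x p == v)%:R].
Proof.
elim: p x => [|y p IHp] x /=.
  move=> _ _; exists set0; split; first exact: sub0set.
    by move=> e; rewrite inE.
  by move=> v; rewrite big_set0 subrr.
case/andP=> /existsP[e /and3P[eB /eqP tle /eqP hde]] pathp /andP[xNyp uniqp].
have [Q [sQB Qtl Qdiv]] := IHp y pathp uniqp.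
have eNQ : e \notin Q.
  by apply: contra xNyp => /Qtl; rewrite tle.
exists (e |: Q); split.
- by rewrite subUset sub1set eB.
- move=> e'; rewrite !inE => /orP[/eqP->|/Qtl]; first by rewrite tle eqxx.
  by rewrite inE => ->; rewrite orbT.
- by move=> v; rewrite big_setU1 //= Qdiv /incidence tle hde addrA subrK.
Qed.

(** No arc of [B] leaves the set of vertices reachable from [x], so the net out-degrees on it sum to
    at most 0. As [x] contributes a positive amount, some reachable [y] contributes a negative
    one. *)
Lemma augmenting_arcs (B : {set E}) (x : V) :
  0 < \sum_(e in B) incidence e x ->
  exists (y : V) (Q : {set E}),
    [/\ \sum_(e in B) incidence e y < 0, Q \subset B &
        forall v, \sum_(e in Q) incidence e v = (x == v)%:R - (y == v)%:R].
Proof.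
move=> x_gt0; pose S := [pred v | connect (arc_rel B) x v].
have sum_le0 : \sum_(v in S) \sum_(e in B) incidence e v <= 0.
  rewrite exchange_big /=; apply: sumr_le0 => e eB.
  rewrite /incidence sumrB.
  have sum_delta (w : V) : \sum_(v in S) (w == v)%:R = (w \in S)%:R :> int.
    have [wS|wNS] := boolP (w \in S).
      rewrite (bigD1 w) //= eqxx big1 ?addr0 // => v /andP[_ /negPf vw].
      by rewrite eq_sym vw.
    rewrite big1 // => v vS; case: eqP => // wv.
    by rewrite wv vS in wNS.
  rewrite !sum_delta.
  have : tl e \in S -> hd e \in S.
    rewrite !inE => xtl; apply: connect_trans xtl (connect1 _).
    by apply/existsP; exists e; rewrite eB !eqxx.
  by case: (tl e \in S); case: (hd e \in S) => // /(_ isT).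
have [/existsP[y /andP[yS y_lt0]] | noneg] :=
    boolP [exists y in S, \sum_(e in B) incidence e y < 0].
  have /connectP[p xp yE] : connect (arc_rel B) x y by [].
  move: yE; case/shortenP: xp => p' xp' uniqp' _ yE.
  have [Q [sQB _ Qdiv]] := path_arcs xp' uniqp'.
  by exists y, Q; split=> // v; rewrite Qdiv yE.
have ge0 y : y \in S -> 0 <= \sum_(e in B) incidence e y.
  move=> yS; rewrite leNgt; apply: contra noneg => y_lt0.
  by apply/existsP; exists y; rewrite yS.
have xS : x \in S by rewrite inE connect0.
move: sum_le0; rewrite (bigD1 x) //= leNgt ltr_wpDr //.
by apply: sumr_ge0 => y /andP[yS _]; exact: ge0.
Qed.

End Digraph.

(** * Balanced edge colourings *)

Section Balanced.
Variables (V E : finType) (tl hd : E -> V) (l : nat).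

Definition colour_div (c : {ffun E -> 'I_l.+1}) (i : 'I_l.+1) (v : V) : int :=
  \sum_(e | c e == i) incidence tl hd e v.

Definition colour_energy (c : {ffun E -> 'I_l.+1}) : int :=
  \sum_v \sum_i colour_div c i v ^+ 2.

Lemma colour_energy_decrease (c : {ffun E -> 'I_l.+1}) (i j : 'I_l.+1) (x : V) :
  i != j -> 2 <= colour_div c i x - colour_div c j x ->
  exists c', colour_energy c' < colour_energy c.
Proof.
move=> ij gap; pose B := [set e | (c e == i) || (c e == j)].
(* Reversing the arcs of colour [j] makes the net out-degree of [B] the difference between those of
   colours [i] and [j]. *)
pose tl' e := if c e == i then tl e else hd e.
pose hd' e := if c e == i then hd e else tl e.
have inc_i e v : c e == i -> incidence tl' hd' e v = incidence tl hd e v.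
  by rewrite /incidence /tl' /hd' => ->.
have inc_j e v : c e == j -> incidence tl' hd' e v = - incidence tl hd e v.
  move=> /eqP cj; rewrite /incidence /tl' /hd' cj [j == i]eq_sym (negPf ij).
  by rewrite opprB.
have split_div (Q : {set E}) v : Q \subset B ->
    \sum_(e in Q) incidence tl' hd' e v
    = \sum_(e in Q | c e == i) incidence tl hd e v
      - \sum_(e in Q | c e == j) incidence tl hd e v.
  move=> /subsetP sQB; rewrite (bigID (fun e => c e == i)) /=; congr (_ + _).
    by apply: eq_bigr => e /andP[_ /inc_i].
  rewrite -sumrN; apply: eq_big => [e|e /andP[eQ eNi]].
    have [eQ /=|//] := boolP (e \in Q).
    have := sQB e eQ; rewrite inE.
    by have [->|_ /= ->] := eqVneq (c e) i; rewrite ?(negPf ij).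
  by apply: inc_j; have := sQB e eQ; rewrite inE (negPf eNi).
have divB v : \sum_(e in B) incidence tl' hd' e v
              = colour_div c i v - colour_div c j v.
  rewrite split_div //; congr (_ - _); apply: eq_bigl => e; rewrite inE;
  by case: (c e == i); case: (c e == j).
have [|y [Q [y_lt0 sQB Qdiv]]] := @augmenting_arcs _ _ tl' hd' B x.
  by rewrite divB (lt_le_trans _ gap).
rewrite divB in y_lt0.
pose c' : {ffun E -> 'I_l.+1} :=
  [ffun e => if e \in Q then (if c e == i then j else i) else c e].
pose t v : int := (x == v)%:R - (y == v)%:R.
have c'_other k v : k != i -> k != j -> colour_div c' k v = colour_div c k v.
  move=> ki kj; apply: eq_bigl => e; rewrite ffunE; case: ifP => // eQ.
  have := subsetP sQB e eQ; rewrite inE => /orP[]/eqP->.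
    by rewrite eqxx ![_ == k]eq_sym (negPf ki) (negPf kj).
  by rewrite [j == i]eq_sym (negPf ij) ![_ == k]eq_sym (negPf ki) (negPf kj).
have inB e : e \in Q -> (c e == j) = ~~ (c e == i).
  move=> eQ; have := subsetP sQB e eQ; rewrite inE.
  by have [->|_ /= ->] := eqVneq (c e) i; rewrite ?(negPf ij).
have divQ k v (d : {ffun E -> 'I_l.+1}) : colour_div d k v
    = \sum_(e in Q | d e == k) incidence tl hd e v
      + \sum_(e | (e \notin Q) && (d e == k)) incidence tl hd e v.
  rewrite /colour_div (bigID (mem Q)) /=; congr (_ + _); apply: eq_bigl => e;
  exact: andbC.
have outQ k v : \sum_(e | (e \notin Q) && (c' e == k)) incidence tl hd e v
    = \sum_(e | (e \notin Q) && (c e == k)) incidence tl hd e v.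
  by apply: eq_bigl => e; rewrite ffunE; case: (e \in Q).
(* Colour [i] trades its arcs in [Q] for those of colour [j], which lowers its net out-degree by
   that of [Q] in the partly reversed digraph, namely [t]. *)
have c'_i v : colour_div c' i v = colour_div c i v - t v.
  rewrite /t -Qdiv split_div // !divQ outQ.
  rewrite (eq_bigl (fun e => (e \in Q) && (c e == j))); first by ring.
  move=> e; rewrite ffunE; case: (boolP (e \in Q)) => //= eQ.
  rewrite inB //; case: (c e == i); rewrite /= ?eqxx //.
  by rewrite eq_sym (negPf ij).
have c'_j v : colour_div c' j v = colour_div c j v + t v.
  rewrite /t -Qdiv split_div // !divQ outQ.
  rewrite (eq_bigl (fun e => (e \in Q) && (c e == i))); first by ring.
  move=> e; rewrite ffunE; case: (boolP (e \in Q)) => //= eQ.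
  by case: (c e == i); rewrite /= ?eqxx // (negPf ij).
exists c'; rewrite -subr_lt0 /colour_energy -sumrB.
pose g v := colour_div c i v - colour_div c j v.
(* With values [a] and [b] for colours [i] and [j], the squares change from [a^2 + b^2] to
   [(a - t)^2 + (b + t)^2]. *)
have -> : \sum_v (\sum_k colour_div c' k v ^+ 2 - \sum_k colour_div c k v ^+ 2)
    = \sum_v 2 * (t v ^+ 2 - t v * g v).
  apply: eq_bigr => v _.
  have ji : j != i by rewrite eq_sym.
  rewrite !(bigD1 (P := fun _ => true) i) //= !(bigD1 (P := fun k => k != i) j) //=.
  rewrite (eq_bigr (fun k => colour_div c k v ^+ 2)) => [|k /andP[ki kj]].
    by rewrite c'_i c'_j /g; ring.
  by rewrite c'_other.
have xy : x != y.
  by apply/eqP => xy; move: gap y_lt0; rewrite -xy; lia.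
(* Here [t] is 1 at [x], -1 at [y] and 0 elsewhere. The gap of 2 makes the term at [x] negative;
   integrality gives [g y <= -1], so the term at [y] is at most 0. *)
rewrite (bigD1 x) //= (bigD1 y) 1?eq_sym //= big1 => [|v /andP[vx vy]].
  rewrite /t !eqxx (negPf xy) eq_sym (negPf xy) /g.
  by move: gap y_lt0; lia.
by rewrite /t ![_ == v]eq_sym (negPf vx) (negPf vy); ring.
Qed.

(** In a colouring of least energy the values at a vertex differ pairwise by at most 1, and their
    average is the integer [f v]. *)
Lemma balanced_colouring (f : V -> int) :
  (forall v, \sum_e incidence tl hd e v = l.+1%:Z * f v) ->
  exists c, forall i v, colour_div c i v = f v.
Proof.
move=> total.
pose c := [arg min_(c < [ffun=> ord0]) colour_energy c]%O.
have cmin c' : colour_energy c <= colour_energy c'.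
  by rewrite /c; case: arg_minP => // c0 _ ->.
have sum_div v : \sum_i colour_div c i v = \sum_(i < l.+1) f v.
  rewrite sumr_const card_ord -[RHS]mulr_natl natz -total.
  by rewrite (partition_big c predT).
exists c => i v; apply/eqP; apply: contraT => neq.
have neg_gap i' j' : ~ 2 <= colour_div c i' v - colour_div c j' v.
  move=> gap; have ij' : i' != j'.
    by apply/eqP => ij'; move: gap; rewrite ij' subrr.
  have [c'] := colour_energy_decrease ij' gap.
  by rewrite ltNge cmin.
(* One value below [f v] keeps all the others at most [f v], so the sum is too small; a value above
   is excluded symmetrically. *)
have [lt_f|ge_f] := ltP (colour_div c i v) (f v).
  have : \sum_j colour_div c j v < \sum_(j < l.+1) f v.
    rewrite (bigD1 i) //= [ltRHS](bigD1 i) //=; apply: ltr_leD => //.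
    apply: ler_sum => j _; move: (neg_gap j i); lia.
  by rewrite sum_div ltxx.
have gt_f : f v < colour_div c i v by rewrite lt_neqAle eq_sym neq.
have : \sum_(j < l.+1) f v < \sum_j colour_div c j v.
  rewrite (bigD1 i) //= [ltRHS](bigD1 i) //=; apply: ltr_leD => //.
  apply: ler_sum => j _; move: (neg_gap i j); lia.
by rewrite sum_div ltxx.
Qed.

End Balanced.

(** * Even edge sets *)

Section EvenSets.
Variable G : multigraph.
Implicit Types (A B C : {set edge G}) (s : signature G) (D : orientation G).

Definition degree A (v : vertex G) : nat := \sum_(e in A) (v \in ends e).

Definition adjacent B : rel (vertex G) :=
  [rel x y | [exists e in B, ends e == [set x; y]]].

(** Handshake argument: if [y] were not reachable, [x] would be the only odd vertex of its
    component, whose degree sum is even. *)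
Lemma odd_connect B (x y : vertex G) :
  odd (degree B x) -> (forall v, v != x -> v != y -> ~~ odd (degree B v)) ->
  connect (adjacent B) x y.
Proof.
move=> oddx even_other; apply: contraT => Nxy.
pose S := [pred v | connect (adjacent B) x v].
have even_sum : ~~ odd (\sum_(v in S) degree B v).
  rewrite exchange_big /=; apply: (big_ind (fun n => ~~ odd n)) => //.
    by move=> m n; rewrite oddD => /negPf-> /negPf->.
  move=> e eB.
  have /eqP/cards2P[a [b [ab endse]]] := ends_card e.
  have Sab : (a \in S) = (b \in S).
    have adj : adjacent B a b by apply/existsP; exists e; rewrite eB endse eqxx.
    have adj' : adjacent B b a.
      by apply/existsP; exists e; rewrite eB endse setUC eqxx.
    by apply/idP/idP; rewrite !inE => xc; apply: connect_trans xc (connect1 _).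
  have -> : (\sum_(v in S) (v \in ends e) = (a \in S) + (b \in S))%N.
    rewrite big_mkcond (bigD1 a) //= (bigD1 b) 1?eq_sym //= big1 ?addn0.
      by rewrite endse !inE !eqxx orbT; do 2!case: (connect _ _ _).
    move=> v /andP[va vb]; rewrite endse !inE (negPf va) (negPf vb).
    by case: ifP.
  by rewrite Sab addnn odd_double.
move: even_sum; rewrite (bigD1 x) ?inE ?connect0 //= oddD oddx /= negbK.
suff /negPf-> : ~~ odd (\sum_(v in S | v != x) degree B v) by [].
apply: (big_ind (fun n => ~~ odd n)) => //.
  by move=> m n; rewrite oddD => /negPf-> /negPf->.
move=> v /andP[vS vx]; apply: even_other => //.
by apply: contraNneq Nxy => <-.
Qed.

Lemma cycle_of_path A (e0 : edge G) (x y : vertex G) (p : seq (vertex G)) :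
  e0 \in A -> x != y -> ends e0 = [set x; y] ->
  path (adjacent (A :\ e0)) x p -> uniq (x :: p) -> last x p = y ->
  exists C, [/\ is_cycle C, C \subset A & e0 \in C].
Proof.
move=> e0A xy ends0 xp uniqp lastp.
pose k := (size p).+1; pose w i := nth x (x :: p) i.
have k_gt1 : (1 < k)%N.
  by rewrite ltnS lt0n size_eq0; apply: contra_neq xy => p0; rewrite -lastp p0.
(* The default [e0] never arises for [i.+1 < k]; at the last index [e0] is used on purpose, to close
   the cycle. *)
pose edge_at i := odflt e0 [pick e in A :\ e0 | ends e == [set w i; w i.+1]].
have edge_atP i : (i.+1 < k)%N ->
    edge_at i \in A :\ e0 /\ ends (edge_at i) = [set w i; w i.+1].
  rewrite ltnS => /(pathP x xp) /existsP[e /andP[eB ende]].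
  rewrite /edge_at; case: pickP => [e' /andP[-> /eqP->] //|/(_ e)].
  by rewrite eB ende.
pose v (i : 'I_k) := w i.
pose e (i : 'I_k) := if (i.+1 < k)%N then edge_at i else e0.
have w_inj i j : (i < k)%N -> (j < k)%N -> w i = w j -> i = j.
  by move=> ik jk /eqP; rewrite nth_uniq // => /eqP.
have lastE i : (i < k)%N -> ~~ (i.+1 < k)%N -> i = size p.
  by rewrite /k; lia.
have e_inj : injective e.
  move=> i j; rewrite /e; have [ik|iNk] := ifPn; have [jk|jNk] := ifPn.
  (* Equal edges have equal end pairs, so either [i = j], or both [i = j.+1] and [j = i.+1], which
     is absurd. *)
  - have [[_ Ei] [_ Ej]] := (edge_atP _ ik, edge_atP _ jk) => eij.
    move: Ei; rewrite eij Ej => wij; apply/val_inj => /=.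
    have : w i \in [set w j; w j.+1] by rewrite wij !inE eqxx.
    have : w j \in [set w i; w i.+1] by rewrite -wij !inE eqxx.
    rewrite !inE => /orP[/eqP/w_inj-> //|/eqP/w_inj ji].
    move=> /orP[/eqP/w_inj-> //|/eqP/w_inj ij].
    by move: (ji (ltn_ord _) ik) (ij (ltn_ord _) jk); lia.
  - by have [] := edge_atP _ ik; rewrite !inE => /andP[/eqP].
  - by have [] := edge_atP _ jk; rewrite !inE => /andP[/eqP ne _] _ /esym.
  - by move=> _; apply/val_inj; rewrite /= (lastE i) // (lastE j).
exists [set e i | i : 'I_k]; split.
- exists k, v, e; split=> //.
    by move=> i j /w_inj ij; apply/val_inj/ij.
  move=> i; rewrite /e /v /=; have [ik|iNk] := ifPn.
    by rewrite modn_small //; case: (edge_atP _ ik).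
  rewrite (lastE i) // modnn ends0 setUC; congr [set _; _].
  by rewrite -lastp -[RHS]/(nth x (x :: p) (size (x :: p)).-1) nth_last.
- apply/subsetP => _ /imsetP[i _ ->]; rewrite /e; case: ifP => // ik.
  by have [] := edge_atP _ ik; rewrite inE => /andP[].
- apply/imsetP; exists ord_max => //.
  by rewrite /e /= ltnn.
Qed.

(** Deleting an edge [e0] of [A] leaves exactly its two ends with odd degree, so a path avoiding
    [e0] joins them. *)
Lemma even_contains_cycle A :
  A != set0 -> (forall v, ~~ odd (degree A v)) ->
  exists C, [/\ is_cycle C, C \subset A & C != set0].
Proof.
move=> /set0Pn[e0 e0A] evenA.
have /eqP/cards2P[x [y [xy ends0]]] := ends_card e0.
have degE v : degree A v = ((v \in ends e0) + degree (A :\ e0) v)%N.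
  by rewrite /degree (big_setD1 e0).
have /connectP[p xp yE] : connect (adjacent (A :\ e0)) x y.
  apply: odd_connect.
    by move: (evenA x); rewrite degE ends0 !inE eqxx /= negbK.
  move=> v vx vy; move: (evenA v).
  by rewrite degE ends0 !inE (negPf vx) (negPf vy).
move: yE; case/shortenP: xp => p' xp' uniqp' _ yE.
have [C [cycC sCA e0C]] := cycle_of_path e0A xy ends0 xp' uniqp' (esym yE).
by exists C; split=> //; apply/set0Pn; exists e0.
Qed.

(** Each edge has distinct ends [v i] and [v (ordS i)]; as [ordS] is a bijection, both ends
    contribute the same total. *)
Lemma cycle_even C (x : vertex G) : is_cycle C -> ~~ odd (degree C x).
Proof.
case=> k [v [e [k_gt1 v_inj e_inj endse ->]]].
rewrite /degree big_imset /=; last by move=> i j _ _ /e_inj.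
have -> : (\sum_i (x \in ends (e i)) = \sum_i ((v i == x) + (v (ordS i) == x)))%N.
  apply: eq_bigr => i _; have := ends_card (e i).
  rewrite endse cards2 !inE ![x == _]eq_sym.
  case: eqVneq => // neq _; case: eqVneq => //= vx.
  by rewrite -vx eq_sym (negPf neq).
rewrite big_split /= [X in (X + _)%N](reindex_inj (@ordS_inj k)) /=.
by rewrite addnn odd_double.
Qed.

(** Induction on the size of [A]: splitting off a cycle [C] preserves evenness, and inversing on [C]
    and then on the rest amounts to inversing on [A]. *)
Lemma even_inversing_equiv A s :
  (forall v, ~~ odd (degree A v)) -> inversing_equiv s (inverse_on s A).
Proof.
have [n] := ubnP #|A|; elim: n A s => // n IHn A s; rewrite ltnS => leAn evenA.
have [->|A0] := eqVneq A set0.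
  by exists [::]; split=> //=; apply/ffunP => e; rewrite ffunE inE.
have [C [cycC sCA C0]] := even_contains_cycle A0 evenA.
have [|v|Cs [cycCs sE]] := IHn (A :\: C) (inverse_on s C).
- apply: leq_trans leAn; apply/proper_card.
  rewrite properE subsetDl /=; have /set0Pn[e eC] := C0.
  apply/subsetPn; exists e; first exact: (subsetP sCA).
  by rewrite inE eC.
- move: (evenA v); rewrite /degree (big_setID C) /= (setIidPr sCA) oddD.
  by rewrite (negPf (cycle_even v cycC)).
exists (C :: Cs); split=> [C'|/=].
  by rewrite inE => /orP[/eqP->|/cycCs].
rewrite -sE; apply/ffunP => e; rewrite !ffunE inE.
by have [/(subsetP sCA)->|] := boolP (e \in C).
Qed.

Lemma inversing_equiv_trans s1 s2 s3 :
  inversing_equiv s1 s2 -> inversing_equiv s2 s3 -> inversing_equiv s1 s3.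
Proof.
move=> [Cs [cycCs ->]] [Cs' [cycCs' ->]]; exists (Cs ++ Cs'); split.
  by move=> C; rewrite mem_cat => /orP[/cycCs|/cycCs'].
by rewrite foldl_cat.
Qed.

(** * Net out-degrees and their parity *)

Definition net_outdeg D A (v : vertex G) : int :=
  (outdeg D A v)%:Z - (indeg D A v)%:Z.

Lemma net_outdegE D A v :
  net_outdeg D A v = \sum_(e in A) incidence (tail D) (Defs.head D) e v.
Proof.
have cardE (P : pred (edge G)) :
    #|[set e in A | P e]|%:Z = \sum_(e in A) (P e)%:R :> int.
  rewrite -natz -sum1_card natr_sum big_mkcond [RHS]big_mkcond /=.
  by apply: eq_bigr => e _; rewrite inE; case: (e \in A); case: (P e).
by rewrite sumrB -!cardE.
Qed.

Lemma net_outdeg_sign D s v :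
  net_outdeg D [set: edge G] v
  = net_outdeg D (pos_edges s) v + net_outdeg D (neg_edges s) v.
Proof.
rewrite !net_outdegE (bigID (fun e => s e)) /=.
by congr (_ + _); apply: eq_bigl => e; rewrite !inE.
Qed.

Lemma degreeE D A v : degree A v = (outdeg D A v + indeg D A v)%N.
Proof.
have cardE (P : pred (edge G)) :
    #|[set e in A | P e]| = (\sum_(e in A) P e)%N.
  rewrite -sum1_card big_mkcond [RHS]big_mkcond /=.
  by apply: eq_bigr => e _; rewrite inE; case: (e \in A); case: (P e).
rewrite /outdeg /indeg !cardE -big_split /=; apply: eq_bigr => e _.
have := ends_card e; rewrite (endsE D) cards2 !inE ![v == _]eq_sym.
case: eqVneq => // neq _; case: eqVneq => //= vx.
by rewrite -vx eq_sym (negPf neq).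
Qed.

(** The sum and the difference of out- and in-degree have the same parity, so the two positive parts
    have an even symmetric difference. *)
Lemma equiv_of_net_outdeg D s1 s2 :
  (forall v, net_outdeg D (pos_edges s1) v = net_outdeg D (pos_edges s2) v) ->
  inversing_equiv s1 s2.
Proof.
move=> net12; pose A := [set e | s1 e (+) s2 e].
have -> : s2 = inverse_on s1 A.
  by apply/ffunP => e; rewrite ffunE inE; case: (s1 e); case: (s2 e).
apply: even_inversing_equiv => v.
have : odd (degree (pos_edges s1) v) = odd (degree (pos_edges s2) v).
  by have := net12 v; rewrite /net_outdeg !(degreeE D); lia.
suff : (degree (pos_edges s1) v + degree (pos_edges s2) v
    = degree A v + (degree (pos_edges s1 :&: pos_edges s2) v).*2)%N by lia.
rewrite -addnn /degree !(big_mkcond (fun e => e \in _)) /= -!big_split /=.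
by apply: eq_bigr => e _; rewrite !inE; case: (s1 e); case: (s2 e) => /=;
   rewrite ?addn0 ?add0n.
Qed.

End EvenSets.

(** * Modulo orientations and balanced partitions *)

Theorem theorem4p3 (l : nat) (l_gt0 : (0 < l)%N)
    (G : multigraph) (sigma : signature G) :
  modulo_orientable l sigma <->
  exists P : 'I_l -> {set edge G},
    [/\ edge_partition P,
        forall i : 'I_l, exists s : signature G,
          inversing_equiv sigma s /\ P i = pos_edges s
      & exists D : orientation G, forall (v : vertex G) (i j : 'I_l),
          (outdeg D (P i) v)%:Z - (indeg D (P i) v)%:Z
          = (outdeg D (P j) v)%:Z - (indeg D (P j) v)%:Z].
Proof.
case: l l_gt0 => // l _; split.
  case=> s [D [equiv_s modD]].
  (* After the case split there are [l.+1] colours, and the negative part has [l] times the net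
     out-degree of the positive part; together they give the factor [l.+1]. *)
  have [|c cP] := @balanced_colouring _ _ (tail D) (Defs.head D) l
                    (net_outdeg D (pos_edges s)).
    move=> v; have := modD v; rewrite -/(net_outdeg _ _ _) -/(net_outdeg _ _ _).
    have -> : \sum_e incidence (tail D) (Defs.head D) e v
              = net_outdeg D [set: edge G] v.
      by rewrite net_outdegE; apply: eq_bigl => e; rewrite inE.
    by rewrite (net_outdeg_sign D s) => <-; lia.
  pose P i := [set e | c e == i].
  have netP i v : net_outdeg D (P i) v = net_outdeg D (pos_edges s) v.
    by rewrite -(cP i v) net_outdegE; apply: eq_bigl => e; rewrite inE.
  exists P; split.
  - split=> [i j ij|].
      apply/pred0P => e /=; rewrite !inE.
      by case: eqP => // ->; rewrite (negPf ij).
    apply/setP => e; rewrite inE; apply/bigcupP; exists (c e) => //.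
    by rewrite inE.
  - move=> i; pose si : signature G := [ffun e => c e == i].
    have PE : P i = pos_edges si by apply/setP => e; rewrite !inE ffunE.
    exists si; split=> //; apply: inversing_equiv_trans equiv_s _.
    by apply: (@equiv_of_net_outdeg G D) => v; rewrite -PE netP.
  - by exists D => v i j; rewrite -!/(net_outdeg _ _ _) !netP.
case=> P [[disjP coverP] posP [D netP]].
(* Any class can serve as the positive part; the other [l] classes then form the negative part, with
   [l] times its net out-degree. *)
have [s [equiv_s PE]] := posP ord0.
exists s, D; split=> // v; rewrite -!/(net_outdeg _ _ _) -PE.
have := net_outdeg_sign D s v.
rewrite -PE -coverP net_outdegE partition_disjoint_bigcup //=.
rewrite (eq_bigr (fun=> net_outdeg D (P ord0) v)) => [|i _].
  by rewrite sumr_const card_ord -mulr_natl natz; lia.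
by rewrite -net_outdegE; exact: netP.
Qed.
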